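(* For all integers $n$, $r$ and $k$ with $n\ge r-1\ge 0$, $$\sum_{j=r-1}^n\left\{{n+1\atop j+1}\right\}_r\widehat c_j^{(k)}=\sum_{\ell=1}^{r}(-1)^{r-\ell}\left[{r\atop \ell}\right]\sum_{i=0}^{n-r+\ell}\binom{n-r+\ell}{i}\frac{(-1)^i}{(i+1)^k}.$$
   Context: For an integer $k$, the poly-Cauchy numbers of the second kind $\widehat c_n^{(k)}$ are defined by $\mathrm{Lif}_k(-\log(1+x))=\sum_{n\ge0}\widehat c_n^{(k)}x^n/n!$, where $\mathrm{Lif}_k(z)=\sum_{m\ge0}\frac{z^m}{m!(m+1)^k}$. $\left[{n\atop m}\right]$ denotes the unsigned Stirling number of the first kind, defined by $x(x+1)\cdots(x+n-1)=\sum_{m}\left[{n\atop m}\right]x^m$. For $r\ge 0$, the $r$-Stirling number of the second kind $\left\{{n\atop m}\right\}_r$ is the number of ways to partition $\{1,\dots,n\}$ into $m$ nonempty disjoint blocks such that $1,\dots,r$ lie in distinct blocks; equivalently $\left\{{n\atop m}\right\}_r=0$ for $n<r$, $\left\{{r\atop m}\right\}_r=\delta_{m,r}$, and $\left\{{n\atop m}\right\}_r=m\left\{{n-1\atop m}\right\}_r+\left\{{n-1\atop m-1}\right\}_r$ for $n>r$. *)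

(* Defs.v *)
From mathcomp Require Import all_boot all_order all_algebra.

Set Implicit Arguments.
Unset Strict Implicit.
Unset Printing Implicit Defensive.

Import Order.TTheory GRing.Theory Num.Theory.
Local Open Scope ring_scope.

(* A formal power series over Q is its coefficient sequence: f stands for
   f 0 + f 1 x + f 2 x^2 + ...  *)
Definition fps := nat -> rat.

Definition fps_one : fps := fun n => (n == 0%N)%:R.

Definition fps_mul (f g : fps) : fps :=
  fun n => \sum_(i < n.+1) f i * g (n - i)%N.

Definition fps_exp (f : fps) (m : nat) : fps := iter m (fps_mul f) fps_one.

(* f(g(x)) = sum_m f_m g(x)^m, for g without constant term; then g^m has no
   terms of degree < m, so only m <= n contributes to the coefficient of x^n
   (see fps_comp_stable). *)
Definition fps_comp (f g : fps) : fps :=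
  fun n => \sum_(m < n.+1) f m * fps_exp g m n.

Lemma fps_exp_small (g : fps) (m n : nat) :
  g 0%N = 0 -> (n < m)%N -> fps_exp g m n = 0.
Proof.
move=> g0; elim: m n => // m IHm n lt_nm.
rewrite /fps_exp iterS -/(fps_exp g m) /fps_mul big_ord_recl g0 mul0r add0r.
rewrite big1 // => i _; rewrite IHm ?mulr0 //= /bump /= add1n.
have ni : (i < n)%N := ltn_ord i.
by rewrite (leq_trans _ (_ : n <= m)%N) // ltn_subrL (leq_ltn_trans _ ni).
Qed.

Lemma fps_comp_stable (f g : fps) (n N : nat) :
  g 0%N = 0 -> (n < N)%N ->
  \sum_(m < N) f m * fps_exp g m n = fps_comp f g n.
Proof.
move=> g0 lt_nN; rewrite /fps_comp.
rewrite [RHS](big_ord_widen N (fun m => f m * fps_exp g m n) lt_nN).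
rewrite [RHS]big_mkcond; apply: eq_bigr => m _.
by case: ltnP => // lt_nm; rewrite fps_exp_small ?mulr0.
Qed.

(* Lif_k(z) = sum_m z^m / (m! (m+1)^k); the power ^ k is the integer power. *)
Definition Lif (k : int) : fps :=
  fun m => (m`!%:R * (m.+1%:R : rat) ^ k)^-1.

(* log(1 + x) = sum_{n >= 1} (-1)^(n-1) x^n / n *)
Definition log1p : fps :=
  fun n => if n is n'.+1 then (-1) ^+ n' / n'.+1%:R else 0.

(* Lif_k(- log(1 + x)) = sum_n polyCauchy2 k n * x^n / n! *)
Definition polyCauchy2 (k : int) (n : nat) : rat :=
  n`!%:R * fps_comp (Lif k) (fun i => - log1p i) n.

(* x (x + 1) ... (x + n - 1) = sum_m (stirling1 n m) x^m *)
Definition stirling1 (n m : nat) : nat :=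
  ((\prod_(i < n) ('X + (i : nat)%:P) : {poly nat})`_m)%R.

(* The elements 1, ..., n are represented by 0, ..., n - 1 in 'I_n, so that
   1, ..., r are the i : 'I_n with i < r. When n < r these elements do not all
   exist, and the number is 0. *)
Definition rStirling2 (r n m : nat) : nat :=
  if (r <= n)%N then
    #|[set P : {set {set 'I_n}} |
        [&& partition P [set: 'I_n], #|P| == m &
            [forall i : 'I_n, forall j : 'I_n,
               [&& (i < r)%N, (j < r)%N & i != j] ==>
               (pblock P i != pblock P j)]]]|
  else 0%N.

(* Main.v *)
(** Let [L] be the linear functional on [Q[X]] with [L (X^m) = 1 / (m+1)^k].
    Since [(1+x) d/dx] is a derivation sending [- log (1+x)] to [-1], the
    coefficients of the powers of [- log (1+x)] satisfy the recurrence of those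
    of the falling factorials [(-X)(-X-1)...(-X-j+1)], so that the [j]-th
    poly-Cauchy number is the value of [L] at the [j]-th one. The right-hand
    side is [L ((1-X)^(n-r+1) (-X)(-X-1)...(-X-r+2))], and the theorem is [L]
    applied to a polynomial identity in [X]. Writing [t = 1 - X], this identity
    says that, for [t] a natural number, the maps from [n+1] points to [t]
    points that are injective on the first [r] points can be counted according
    to their partition into fibres. *)
Require Import Defs.
From mathcomp Require Import all_boot all_order all_algebra.
From mathcomp Require Import ring.

Import Order.TTheory GRing.Theory Num.Theory.
Local Open Scope ring_scope.

(** * Counting maps by their partition into fibres *)

(** Such a map is the projection of [T] onto the blocks of [P] followed by an injection of the
    blocks into [R], and this factorization is unique. *)
Lemma card_ffun_preim_partition (T R : finType) (P : {set {set T}}) :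
  partition P [set: T] ->
  #|[set f : {ffun T -> R} | preim_partition f [set: T] == P]| =
  (#|R| ^_ #|P|)%N.
Proof.
move=> partP; have /and3P[/eqP covP tiP nP0] := partP.
have Pblk x : pblock P x \in P by rewrite pblock_mem // covP inE.
pose blk x : {B : {set T} | B \in P} := exist _ (pblock P x) (Pblk x).
(* Choose a point in each block; this is possible because blocks are nonempty. *)
have [sec secK] : exists sec, forall B, blk (sec B) = B.
  apply: (fin_all_exists (P := fun B x => blk x = B)) => -[B PB].
  have [B0|[x xB]] := set_0Vmem B; first by rewrite -B0 PB in nP0.
  by exists x; apply: val_inj; rewrite /= (def_pblock tiP PB xB).
pose F (g : {ffun {B : {set T} | B \in P} -> R}) : {ffun T -> R} :=
  [ffun x => g (blk x)].
have F_inj : injective F.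
  by move=> g h /ffunP e; apply/ffunP => B; have := e (sec B);
     rewrite !ffunE secK.
have <- : #|F @: [set g : {ffun _ -> R} | injectiveb g]| = (#|R| ^_ #|P|)%N.
  by rewrite card_imset // card_inj_ffuns card_sig.
apply: eq_card => f; rewrite inE.
apply/eqP/imsetP => [fP | [g]].
- have f_blk x y : (f x == f y) = (blk x == blk y).
    rewrite -val_eqE /= eq_pblock // ?covP ?inE // -fP.
    rewrite pblock_equivalence_partition ?inE //.
    by split=> // /eqP ->.
  exists [ffun B => f (sec B)].
    rewrite inE; apply/injectiveP => B C; rewrite !ffunE => /eqP.
    by rewrite f_blk !secK => /eqP.
  by apply/ffunP => x; rewrite !ffunE; apply/eqP; rewrite f_blk secK.
- rewrite inE => /injectiveP g_inj ->.
  rewrite -[RHS](equivalence_partition_pblock partP).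
  apply: eq_imset => x; apply/setP => y; rewrite !inE !ffunE /=.
  by rewrite (inj_eq g_inj) -val_eqE /= eq_pblock // covP inE.
Qed.

Lemma card_ffun_inj_lshift (R : finType) (r d : nat) :
  #|[set f : {ffun 'I_(r + d) -> R} |
      injectiveb (fun i : 'I_r => f (lshift d i))]| =
  (#|R| ^_ r * #|R| ^ d)%N.
Proof.
pose F (gh : {ffun 'I_r -> R} * {ffun 'I_d -> R}) : {ffun 'I_(r + d) -> R} :=
  [ffun i => match split i with inl a => gh.1 a | inr b => gh.2 b end].
have Fl gh a : F gh (lshift d a) = gh.1 a.
  by rewrite ffunE (unsplitK (inl a)).
have Fr gh b : F gh (rshift r b) = gh.2 b.
  by rewrite ffunE (unsplitK (inr b)).
have F_inj : injective F.
  move=> [g h] [g' h'] e; congr pair; apply/ffunP => i.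
  - by rewrite -[g i](Fl (g, h)) e Fl.
  - by rewrite -[h i](Fr (g, h)) e Fr.
transitivity
  #|F @: setX [set g : {ffun 'I_r -> R} | injectiveb g] setT|; last first.
  by rewrite card_imset // cardsX card_inj_ffuns cardsT card_ffun !card_ord.
apply: eq_card => f; rewrite inE.
apply/injectiveP/imsetP => [f_inj | [gh]].
- exists ([ffun i => f (lshift d i)], [ffun i => f (rshift r i)]).
    rewrite !inE andbT; apply/injectiveP => i j.
    by rewrite !ffunE => /f_inj.
  apply/ffunP => i; rewrite ffunE.
  by case: splitP => j ij; rewrite /= ffunE; congr (f _); apply: val_inj.
- rewrite !inE andbT => /injectiveP g_inj -> i j.
  by rewrite !Fl => /g_inj.
Qed.

(** The [r] distinguished points lie in [r] distinct blocks, so there are at least [r] blocks. *)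
Lemma rStirling2_small (r n m : nat) : (m < r)%N -> rStirling2 r n m = 0%N.
Proof.
move=> lt_mr; rewrite /rStirling2; case: leqP => // le_rn.
apply/eqP; rewrite cards_eq0 -subset0; apply/subsetP => P.
rewrite inE => /and3P[/and3P[/eqP covP _ _] /eqP cardP sepP].
suff : (#|'I_r| <= #|P|)%N by rewrite card_ord cardP leqNgt lt_mr.
pose w := widen_ord le_rn.
have inj : injective (fun i => pblock P (w i)).
  move=> i j /eqP; apply: contraTeq => neq_ij.
  have /forallP/(_ (w i))/forallP/(_ (w j))/implyP := sepP.
  by apply; rewrite -val_eqE /= !ltn_ord.
rewrite -cardsT -(card_imset [set: 'I_r] inj); apply: subset_leq_card.
by apply/subsetP => _ /imsetP[i _ ->]; rewrite pblock_mem // covP inE.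
Qed.

(** Double counting of the maps to [t] points that are injective on the first [r] points: this
    injectivity means exactly that the fibre partition separates these points. *)
Lemma sum_rStirling2_ffact (r d t : nat) :
  (\sum_(m < (r + d).+1) rStirling2 r (r + d) m * t ^_ m = t ^_ r * t ^ d)%N.
Proof.
have -> : (t ^_ r * t ^ d)%N =
    (#|'I_t| ^_ r * #|'I_t| ^ d)%N by rewrite card_ord.
rewrite -card_ffun_inj_lshift -sum1_card.
pose sep (P : {set {set 'I_(r + d)}}) :=
  [forall i : 'I_(r + d), forall j : 'I_(r + d),
     [&& (i < r)%N, (j < r)%N & i != j] ==> (pblock P i != pblock P j)].
have sepE (f : {ffun 'I_(r + d) -> 'I_t}) :
    injectiveb (fun i : 'I_r => f (lshift d i)) =
    sep (preim_partition f [set: 'I_(r + d)]).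
  have /and3P[/eqP covP tiP _] := preim_partitionP f [set: 'I_(r + d)].
  have f_blk i j : (pblock (preim_partition f setT) i ==
                    pblock (preim_partition f setT) j) = (f i == f j).
    rewrite eq_pblock ?covP ?inE // pblock_equivalence_partition ?inE //.
    by split=> // /eqP ->.
  apply/injectiveP/forallP => [f_inj i | sepf i j /eqP].
  - apply/forallP => j; apply/implyP => /and3P[ir jr]; rewrite f_blk.
    apply: contra => /eqP fij.
    have E (a : 'I_(r + d)) (ar : (a < r)%N) : a = lshift d (Ordinal ar).
      by apply: val_inj.
    by move: fij; rewrite (E i ir) (E j jr) => /f_inj ->.
  - rewrite -f_blk; apply: contraTeq => neq_ij.
    have /forallP/(_ (lshift d j))/implyP := sepf (lshift d i).
    by apply; rewrite -val_eqE /= !ltn_ord.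
have cardP (P : {set {set 'I_(r + d)}}) :
    partition P [set: 'I_(r + d)] -> (#|P| < (r + d).+1)%N.
  move=> partP; rewrite ltnS -(card_transversal (transversalP partP)).
  by rewrite -[leqRHS](card_ord (r + d)) max_card.
transitivity (\sum_(P : {set {set 'I_(r + d)}} |
    partition P [set: 'I_(r + d)] && sep P) t ^_ #|P|)%N.
(* Group the partitions by their number of blocks; by [cardP] it is in range, so [inord] preserves
   it. *)
- rewrite [RHS](partition_big (fun P : {set {set 'I_(r + d)}} =>
      inord #|P| : 'I_(r + d).+1) xpredT) //=.
  apply: eq_bigr => m _; rewrite /rStirling2 leq_addr -sum1_card big_distrl /=.
  apply: eq_big => [P | P].
  + rewrite inE; case: (boolP (partition P _)) => //= partP.
    by rewrite -/(sep P) andbC -val_eqE /= inordK // cardP.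
  + by rewrite inE => /and3P[_ /eqP -> _]; rewrite mul1n.
- rewrite [RHS](partition_big (fun f : {ffun 'I_(r + d) -> 'I_t} =>
      preim_partition f [set: 'I_(r + d)])
      (fun P => partition P [set: 'I_(r + d)] && sep P)); last first.
    by move=> f; rewrite inE sepE => ->; rewrite preim_partitionP.
  apply: eq_bigr => P /andP[partP sepP].
  rewrite -[t in LHS]card_ord -card_ffun_preim_partition // -sum1_card.
  apply: eq_bigl => f; rewrite !inE.
  by case: eqP => [fP|_]; rewrite ?andbF // sepE fP sepP.
Qed.

(** * The powers of [- log (1 + x)] *)

(* The operator [(1 + x) d/dx]. *)
Definition fps_theta (f : fps) : fps :=
  fun n => n.+1%:R * f n.+1 + n%:R * f n.

Lemma fps_theta_mul (f g : fps) (n : nat) :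
  fps_theta (fps_mul f g) n =
  fps_mul (fps_theta f) g n + fps_mul f (fps_theta g) n.
Proof.
(* Leibniz rule for [x d/dx], from [N = i + (N - i)]. It serves at [N = n + 1] for [d/dx] and at
   [N = n] for [x d/dx]. *)
have Euler N : N%:R * fps_mul f g N =
    \sum_(i < N.+1) i%:R * f i * g (N - i)%N +
    \sum_(i < N.+1) f i * ((N - i)%:R * g (N - i)%N).
  rewrite /fps_mul mulr_sumr -big_split; apply: eq_bigr => i _ /=.
  have -> : (N%:R : rat) = i%:R + (N - i)%:R by rewrite -natrD subnKC // -ltnS.
  by ring.
(* For [N = n + 1], the first term of the first sum and the last term of the second carry a factor
   zero. *)
rewrite /fps_theta !Euler big_ord_recl [X in _ + X + _]big_ord_recr /=.
rewrite subnn !mul0r !mulr0 add0r addr0 /fps_mul -!big_split /=.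
apply: eq_bigr => i _; rewrite subSS subSn -1?ltnS //.
by rewrite /bump /= add1n; ring.
Qed.

Notation neglog1p := (fun i => - log1p i).

Lemma fps_theta_neglog1p (n : nat) : fps_theta neglog1p n = - fps_one n.
Proof.
rewrite /fps_theta /fps_one /log1p; case: n => [|n] /=; first by rewrite mul0r.
by rewrite exprS; field; rewrite nat1r -natrD !pnatr_eq0.
Qed.

(** Power rule for a derivation, with [- log (1 + x)] sent to [-1]. For [m = 0] the factor [m] makes
    the value of [m.-1] irrelevant. *)
Lemma fps_theta_exp (m n : nat) :
  fps_theta (fps_exp neglog1p m) n = - (m%:R * fps_exp neglog1p m.-1 n).
Proof.
elim: m n => [|m IHm] n.
  by rewrite /fps_theta /= /fps_one mulr0 add0r mul0r oppr0; case: n => [|n];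
     rewrite ?mul0r ?mulr0.
rewrite /fps_exp iterS -/(fps_exp neglog1p m) fps_theta_mul /=.
have -> : fps_mul (fps_theta neglog1p) (fps_exp neglog1p m) n =
    - fps_exp neglog1p m n.
  rewrite /fps_mul big_ord_recl fps_theta_neglog1p subn0 mulN1r big1 ?addr0 //.
  by move=> i _; rewrite fps_theta_neglog1p oppr0 mul0r.
have -> : fps_mul neglog1p (fps_theta (fps_exp neglog1p m)) n =
    - (m%:R * fps_exp neglog1p m n).
  case: m IHm => [|m] IHm.
    rewrite mul0r oppr0 /fps_mul big1 // => i _.
    by rewrite IHm mul0r oppr0 mulr0.
  rewrite [in RHS]/fps_exp iterS -/(fps_exp neglog1p m) /fps_mul mulr_sumr.
  by rewrite -sumrN; apply: eq_bigr => i _; rewrite IHm /=; ring.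
by rewrite -natr1; ring.
Qed.

(** * Falling factorials *)

(** The exponential generating function of these polynomials is [(1 + x)^(-X)]. *)
Definition ffactN (n : nat) : {poly rat} := \prod_(i < n) (- 'X - i%:R%:P).

Lemma ffactNS (n : nat) : ffactN n.+1 = ffactN n * (- 'X - n%:R%:P).
Proof. by rewrite /ffactN big_ord_recr. Qed.

(** This is the expansion of [exp (- X log (1 + x))] in powers of [X]. By [fps_theta_exp] the
    right-hand side obeys the recurrence in [n] that multiplication by [- X - n] gives on the
    left. *)
Lemma coef_ffactN (n m : nat) :
  (ffactN n)`_m = n`!%:R / m`!%:R * fps_exp neglog1p m n.
Proof.
have fact_neq0 j : (j`!%:R : rat) != 0 by rewrite pnatr_eq0 -lt0n fact_gt0.
elim: n m => [|n IHn] m.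
  rewrite /ffactN big_ord0 coef1; case: m => [|m].
    by rewrite /= /fps_one divr1 mulr1.
  by rewrite fps_exp_small ?mulr0 // oppr0.
have := fps_theta_exp m n; rewrite /fps_theta => e_rec.
have -> : (n.+1)`!%:R / m`!%:R * fps_exp neglog1p m n.+1 =
    n`!%:R / m`!%:R * (n.+1%:R * fps_exp neglog1p m n.+1) :> rat.
  by rewrite factS natrM; ring.
rewrite -(addrK (n%:R * fps_exp neglog1p m n) (n.+1%:R * _)) e_rec.
rewrite ffactNS mulrBr mulrN coefB coefN coefMX coefMC !IHn.
case: m {e_rec} => [|m] /=; first by ring.
rewrite factS natrM; field.
by rewrite fact_neq0 addrC natr1 pnatr_eq0.
Qed.

Lemma size_ffactN (n : nat) : (size (ffactN n) <= n.+1)%N.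
Proof.
by apply/leq_sizeP => m lt_nm; rewrite coef_ffactN fps_exp_small ?mulr0.
Qed.

Lemma horner_ffactN (n y : nat) : (ffactN n).[- y%:R] = (y ^_ n)%:R.
Proof.
elim: n => [|n IHn]; first by rewrite /ffactN big_ord0 hornerC.
rewrite ffactNS hornerM IHn !hornerE opprK ffactnSr natrM.
(* When [y < n] the subtraction in [nat] truncates, but [y ^_ n] is already zero. *)
have [le_ny | lt_yn] := leqP n y; first by rewrite natrB.
by rewrite ffact_small // !mul0r.
Qed.

Lemma poly_nat_ext (p q : {poly rat}) :
  (forall y : nat, p.[- y%:R] = q.[- y%:R]) -> p = q.
Proof.
move=> pq; apply/eqP; rewrite -subr_eq0; apply/eqP.
apply: (@roots_geq_poly_eq0 _ _ [seq - y%:R | y <- iota 0 (size (p - q))]).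
- by apply/allP => _ /mapP[y _ ->]; rewrite /root hornerD hornerN pq subrr.
- rewrite map_inj_uniq ?iota_uniq // => x y /oppr_inj /eqP.
  by rewrite eqr_nat => /eqP.
- by rewrite size_map size_iota.
Qed.

(** At [X = - y] this is the counting identity for [r = s + 1] and [t = y + 1], divided by the
    common factor [y + 1]. *)
Lemma sum_rStirling2_ffactN (s d : nat) :
  \sum_(j < (s + d).+1) (rStirling2 s.+1 (s + d).+1 j.+1)%:R *: ffactN j =
  (1 - 'X) ^+ d * ffactN s.
Proof.
apply: poly_nat_ext => y.
rewrite horner_sum hornerM horner_exp !hornerE opprK nat1r horner_ffactN.
under eq_bigr => j _ do rewrite hornerZ horner_ffactN -natrM.
rewrite -natr_sum -natrX -natrM; congr (_%:R); apply/eqP.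
rewrite -(eqn_pmul2l (ltn0Sn y)); apply/eqP.
have := sum_rStirling2_ffact s.+1 d y.+1; rewrite big_ord_recl.
rewrite rStirling2_small // mul0n add0n ffactnS /= => e.
rewrite mulnCA [RHS]mulnC -e big_distrr /=; apply: eq_bigr => j _.
by rewrite ffactnS /bump /= add1n mulnCA.
Qed.

Lemma stirling1S (n m : nat) :
  stirling1 n.+1 m.+1 = (stirling1 n m + n * stirling1 n m.+1)%N.
Proof.
rewrite /stirling1 big_ord_recr /= mulrDr coefD coefMX coefMC /=.
by congr (_ + _)%N; rewrite mulnC.
Qed.

Lemma stirling1S0 (n : nat) : stirling1 n.+1 0 = 0%N.
Proof. by rewrite /stirling1 big_ord_recl addr0 mulrC coefMX. Qed.

(** The product is [X (X - 1) ... (X - s)] divided by [X], hence signed Stirling numbers with both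
    indices shifted by one. *)
Lemma coef_prod_XsubC_stirling1 (s l : nat) :
  (\prod_(i < s) ('X - i.+1%:R%:P) : {poly rat})`_l =
  (-1) ^+ (s + l) * (stirling1 s.+1 l.+1)%:R.
Proof.
elim: s l => [|s IHs] l.
  rewrite big_ord0 coef1 /stirling1 big_ord_recr big_ord0 /= mul1r addr0 coefX.
  by case: l => [|l]; rewrite ?mulr0 ?mulr1.
rewrite big_ord_recr /= mulrBr coefB coefMX coefMC !IHs.
rewrite (stirling1S s.+1) natrD natrM.
case: l => [|l] /=; first by rewrite stirling1S0 addSn exprS; ring.
by rewrite addnS addSn addnS !exprS; ring.
Qed.

Lemma prod_XsubC_comp (s : nat) :
  (\prod_(i < s) ('X - i.+1%:R%:P)) \Po (1 - 'X) = ffactN s.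
Proof.
rewrite rmorph_prod; apply: eq_bigr => i _.
by rewrite /= comp_polyB comp_polyX comp_polyC -natr1 polyCD polyC1; ring.
Qed.

Lemma exp_1subX (e : nat) :
  (1 - 'X) ^+ e = \poly_(i < e.+1) ('C(e, i)%:R * (-1) ^+ i) :> {poly rat}.
Proof.
rewrite exprBn poly_def; apply: eq_bigr => i _.
rewrite expr1n mulr1 -mul_polyC polyCM polyC_natr polyC_exp polyCN.
by rewrite -mulrA mulr_natl.
Qed.

(** * The moment functional *)

Definition moment (w : nat -> rat) (p : {poly rat}) : rat :=
  \sum_(i < size p) p`_i * w i.

Lemma moment_wide (w : nat -> rat) (p : {poly rat}) (N : nat) :
  (size p <= N)%N -> moment w p = \sum_(i < N) p`_i * w i.
Proof.
move=> le_pN; rewrite /moment (big_ord_widen N (fun i => p`_i * w i) le_pN).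
rewrite big_mkcond; apply: eq_bigr => i _.
by case: ltnP => // le_pi; rewrite nth_default ?mul0r.
Qed.

Lemma momentD (w : nat -> rat) (p q : {poly rat}) :
  moment w (p + q) = moment w p + moment w q.
Proof.
rewrite (moment_wide w _ _ (size_polyD p q)).
rewrite (moment_wide w _ _ (leq_maxl (size p) (size q))).
rewrite (moment_wide w _ _ (leq_maxr (size p) (size q))) -big_split.
by apply: eq_bigr => i _; rewrite coefD mulrDl.
Qed.

Lemma momentZ (w : nat -> rat) (c : rat) (p : {poly rat}) :
  moment w (c *: p) = c * moment w p.
Proof.
rewrite (moment_wide w _ _ (size_scale_leq c p)) mulr_sumr.
by apply: eq_bigr => i _; rewrite coefZ mulrA.
Qed.

Lemma moment_sum (w : nat -> rat) (N : nat) (c : nat -> rat)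
    (p : nat -> {poly rat}) :
  moment w (\sum_(i < N) c i *: p i) = \sum_(i < N) c i * moment w (p i).
Proof.
rewrite (big_morph (moment w) (momentD w) (_ : moment w 0 = 0)).
  by apply: eq_bigr => i _; rewrite momentZ.
by rewrite /moment size_poly0 big_ord0.
Qed.

Notation Lif_weight k := (fun m => (m.+1%:R ^ k)^-1).

(** The [m!] in the denominator of [Lif] is the one in [coef_ffactN]; only the weight [(m+1)^(-k)]
    remains. *)
Lemma polyCauchy2_moment (k : int) (j : nat) :
  polyCauchy2 k j = moment (Lif_weight k) (ffactN j).
Proof.
rewrite (moment_wide _ _ _ (size_ffactN j)) /polyCauchy2 /fps_comp mulr_sumr.
by apply: eq_bigr => m _; rewrite coef_ffactN /Lif invfM; ring.
Qed.

Lemma moment_exp_1subX (k : int) (e : nat) :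
  moment (Lif_weight k) ((1 - 'X) ^+ e) =
  \sum_(0 <= i < e.+1) 'C(e, i)%:R * ((-1) ^+ i / (i.+1%:R : rat) ^ k).
Proof.
rewrite exp_1subX (moment_wide _ _ _ (size_poly _ _)) big_mkord.
by apply: eq_bigr => i _; rewrite coef_poly ltn_ord mulrA.
Qed.

Theorem theorem4 (n r : nat) (k : int) (hr : (1 <= r)%N) (hn : (r - 1 <= n)%N) :
  \sum_(r - 1 <= j < n.+1) (rStirling2 r n.+1 j.+1)%:R * polyCauchy2 k j =
  \sum_(1 <= l < r.+1) (-1) ^+ (r - l) * (stirling1 r l)%:R *
    (\sum_(0 <= i < (n + l - r).+1)
        'C(n + l - r, i)%:R * ((-1) ^+ i / (i.+1%:R : rat) ^ k)).
Proof.
case: r hr hn => // s _; rewrite subSS subn0 => le_sn.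
have [d ->] : exists d, n = (s + d)%N by exists (n - s)%N; rewrite subnKC.
transitivity (moment (Lif_weight k) ((1 - 'X) ^+ d * ffactN s)).
- rewrite -sum_rStirling2_ffactN.
  rewrite (moment_sum _ _ (fun j => (rStirling2 s.+1 (s + d).+1 j.+1)%:R)).
  rewrite -(big_mkord xpredT (fun j =>
    (rStirling2 s.+1 (s + d).+1 j.+1)%:R * moment _ (ffactN j))).
  have le_sd : (s <= (s + d).+1)%N by rewrite leqW ?leq_addr.
  (* The terms with [j < s] vanish, as [j + 1] blocks cannot separate [s + 1] points. *)
  rewrite [RHS](big_cat_nat (leq0n s) le_sd).
  rewrite [X in _ = X + _]big_nat_cond big1 => [|j]; last first.
    rewrite andbT => /andP[_ lt_js].
    by rewrite rStirling2_small ?mul0r.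
  by rewrite add0r; apply: eq_bigr => j _; rewrite polyCauchy2_moment.
(* Expand the falling factorial in powers of [1 - X]: its coefficients there are those of [Q], and
   each power has a moment given by a binomial sum. *)
- rewrite -prod_XsubC_comp; set Q := \prod_(i < s) _.
  have size_Q : (size Q <= s.+1)%N.
    by rewrite /Q size_prod_XsubC -[index_enum _]enumT size_enum_ord.
  have -> : (1 - 'X) ^+ d * (Q \Po (1 - 'X)) =
      \sum_(l < s.+1) Q`_l *: (1 - 'X) ^+ (d + l).
    rewrite /comp_poly (horner_coef_wide _ (n := s.+1)); last first.
      by rewrite (leq_trans (size_poly _ _)).
    rewrite mulr_sumr; apply: eq_bigr => l _.
    by rewrite coef_map /= mul_polyC exprD scalerAr.
  rewrite (moment_sum _ _ (fun l => Q`_l) (fun l => (1 - 'X) ^+ (d + l))).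
  rewrite big_add1 /= big_mkord; apply: eq_bigr => l _.
  have -> : (s + d + l.+1 - s.+1 = d + l)%N.
    by rewrite addnS subSS -addnA addKn.
  rewrite -moment_exp_1subX /Q coef_prod_XsubC_stirling1 subSS.
  have le_ls : (l <= s)%N by rewrite -ltnS.
  (* The exponents [s + l] and [s - l] have the same parity. *)
  by rewrite -[in LHS]signr_odd -[in RHS]signr_odd oddD oddB.
Qed.
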